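(* Let $u_0\in C^{k,\theta}(\mathbb R)$, $k\in\mathbb Z$, $k\ge0$, $\theta\in[0,1]$, and let $u\in C([-T,T]:C^{k,\theta}(\mathbb R))$ be the corresponding local solution of $$\partial_t u+(1-\partial_x^2)^{-1}(\partial_x u+u\,\partial_x u)=0,\qquad u(x,0)=u_0(x),\quad x\in\mathbb R.$$ Then for all $t\in[-T,T]$ $$\Upsilon_{j,\eta}(u(t))=\Upsilon_{j,\eta}(u_0)\qquad\text{for } j\in\{k,k+1\},\ \eta\in[0,1],\ j+\eta\le k+1+\theta.$$
   Context: $C^{k,\theta}(\mathbb R)$ ($k\ge0$ integer, $\theta\in[0,1]$) is the space of $f:\mathbb R\to\mathbb R$ of class $C^k$ with bounded derivatives up to order $k$ and finite norm $\|f\|_{C^{k,\theta}}=\sum_{i=0}^k\|f^{(i)}\|_\infty+\sup_{h\ne0}\||h|^{-\theta}(f^{(k)}(\cdot+h)-f^{(k)}(\cdot))\|_\infty$. For $\Omega\subset\mathbb R$ open, $C^{k,\theta}(\Omega)$ is the set of restrictions to $\Omega$ of functions in $C^{k,\theta}(\mathbb R)$. For $f:\mathbb R\to\mathbb R$, $$\Upsilon_{k,\theta}(f)=\{x\in\mathbb R: f\text{ is not }C^{k,\theta}\text{ at }x\},$$ where $f$ is $C^{k,\theta}$ at $x$ if there is an open interval $I\ni x$ with $f|_I\in C^{k,\theta}(I)$. The equation is understood in the integral form $u(t)=u_0-\int_0^t\partial_x(1-\partial_x^2)^{-1}\big(u+\tfrac{u^2}{2}\big)(t')\,dt'$, where $\partial_x(1-\partial_x^2)^{-1}g=K*g$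 with $K(x)=-\tfrac12\,\mathrm{sgn}(x)e^{-|x|}$. For every $u_0\in C^{k,\theta}(\mathbb R)$ there exist $T=T(\|u_0\|_{C^{k,\theta}})>0$ and a unique solution $u\in C([-T,T]:C^{k,\theta}(\mathbb R))$. *)

(* Defs.v *)
From Stdlib Require Import Reals.
From Coquelicot Require Import Coquelicot.

Open Scope R_scope.

Definition sup_norm (f : R -> R) : Rbar :=
  Lub_Rbar (fun r => exists x, r = Rabs (f x)).

(* [Rpower (Rabs h) (- theta)] is [|h|^(-theta)] since [h <> 0]; it is [1] when [theta = 0]. *)
Definition holder_seminorm (theta : R) (g : R -> R) : Rbar :=
  Rbar_lub (fun s => exists h, h <> 0 /\
    s = sup_norm (fun x => Rpower (Rabs h) (- theta) * (g (x + h) - g x))).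

(* [a 0 + ... + a n]; only used with nonnegative terms, where [Rbar_plus] has no
   indeterminate case. *)
Fixpoint Rbar_sum (a : nat -> Rbar) (n : nat) : Rbar :=
  match n with
  | O => a O
  | S m => Rbar_plus (Rbar_sum a m) (a (S m))
  end.

Definition holder_norm (k : nat) (theta : R) (f : R -> R) : Rbar :=
  Rbar_plus (Rbar_sum (fun i => sup_norm (Derive_n f i)) k)
            (holder_seminorm theta (Derive_n f k)).

Definition class_C (k : nat) (f : R -> R) : Prop :=
  (forall i x, (i <= k)%nat -> ex_derive_n f i x) /\
  (forall x, continuous (Derive_n f k) x).

Definition bounded (f : R -> R) : Prop :=
  exists M : R, forall x, Rabs (f x) <= M.

Definition holder_space (k : nat) (theta : R) (f : R -> R) : Prop :=
  class_C k f /\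
  (forall i, (i <= k)%nat -> bounded (Derive_n f i)) /\
  is_finite (holder_norm k theta f).

(* Membership of the restriction of [f] to [Omega]; values of [f] off [Omega] are irrelevant. *)
Definition holder_space_on (k : nat) (theta : R) (Omega : R -> Prop) (f : R -> R) : Prop :=
  exists g, holder_space k theta g /\ forall y, Omega y -> f y = g y.

Definition open_interval (a b : Rbar) (y : R) : Prop :=
  Rbar_lt a y /\ Rbar_lt y b.

Definition holder_at (k : nat) (theta : R) (f : R -> R) (x : R) : Prop :=
  exists a b : Rbar,
    open_interval a b x /\ holder_space_on k theta (open_interval a b) f.

Definition Upsilon (k : nat) (theta : R) (f : R -> R) (x : R) : Prop :=
  ~ holder_at k theta f x.

Definition K (x : R) : R := - / 2 * sign x * exp (- Rabs x).

Definition convolution (f g : R -> R) (x : R) : R :=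
  RInt_gen (fun y => f (x - y) * g y) (Rbar_locally m_infty) (Rbar_locally p_infty).

(* [u] belongs to [C([-T,T] : C^{k,theta}(R))]. *)
Definition continuous_curve (T : R) (k : nat) (theta : R) (u : R -> R -> R) : Prop :=
  (forall t, - T <= t <= T -> holder_space k theta (u t)) /\
  (forall t, - T <= t <= T -> forall eps : posreal, exists delta : posreal,
     forall s, - T <= s <= T -> Rabs (s - t) < delta ->
       Rbar_lt (holder_norm k theta (fun x => u s x - u t x)) eps).

(* The [C^{k,theta}]-valued time integral is written pointwise in [x]: it commutes with
   evaluation at [x], a continuous linear functional. *)
Definition integral_equation (T : R) (u0 : R -> R) (u : R -> R -> R) : Prop :=
  forall t x, - T <= t <= T ->
    u t x = u0 x -
      RInt (fun t' => convolution K (fun y => u t' y + (u t' y) ^ 2 / 2) x) 0 t.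

Definition local_solution (T : R) (k : nat) (theta : R) (u0 : R -> R) (u : R -> R -> R) : Prop :=
  continuous_curve T k theta u /\ integral_equation T u0 u.

(* Main.v *)
Require Import Defs.
From Stdlib Require Import Reals Lra Lia Classical ClassicalEpsilon FunctionalExtensionality.
From Coquelicot Require Import Coquelicot.

Open Scope R_scope.

(** The nonlocal term gains one derivative, so [u(t) - u0] lies in [C^{k+1,theta}] on the whole
    line and cannot create or remove singularities of class [C^{j,eta}] when
    [j + eta <= k + 1 + theta].

    Write [g = u + u^2/2], [w = u0 - u(t)], [z] for the integral over [0,t] of
    [(1 - d_x^2)^{-1} g] and [G] for that of [g].  Since [d_x^2 (1 - d_x^2)^{-1} = (1 - d_x^2)^{-1} - 1],
    we have [z' = w] and [w' = z - G].  Now [w] is in [C^{k,theta}] and so is [G], because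
    [C^{k,theta}] is an algebra; hence [z], and then [w'], belong to [C^{k,theta}]. *)

(** * Quantitative Hölder bounds *)

(** No Hölder estimate for the convolution operator is ever made. That [w] lies in $C^{k,\theta}$
    comes from u0 and u(t) both lying there; the equation only serves to write [w] as a time
    integral and differentiate it once. Then z' = w upgrades a mere sup bound on [z] to
    $C^{k+1,\theta}$, so the kernel enters through sup-norm estimates alone. The two identities come
    from splitting the kernel at the origin. With P and Q the integrals of exp(-|x - y|) g(y) over y
    > x and y < x, one has P' = P - g and Q' = g - Q, while convolution with [K] gives (P - Q)/2 and
    $(1-\partial_x^2)^{-1}g$ is (P + Q)/2. [holder_bound] puts one constant on all derivatives and
    on the Hölder quotient, so that estimates go by induction on [k], peeling off one derivative at
    a time. Continuity is a separate clause at order 0 because a Hölder condition of exponent 0 is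
    only boundedness. *)

Fixpoint holder_bound (k : nat) (theta M : R) (f : R -> R) : Prop :=
  (forall x, Rabs (f x) <= M) /\
  match k with
  | O => (forall x, continuous f x) /\
         forall x h, h <> 0 -> Rabs (f (x + h) - f x) <= M * Rpower (Rabs h) theta
  | S k' => exists f', (forall x, is_derive f x (f' x)) /\ holder_bound k' theta M f'
  end.

Lemma holder_bound_abs k theta M f x : holder_bound k theta M f -> Rabs (f x) <= M.
Proof. destruct k; intros H; apply H. Qed.

Lemma holder_bound_ge0 k theta M f : holder_bound k theta M f -> 0 <= M.
Proof.
  intros H. apply Rle_trans with (Rabs (f 0)); [apply Rabs_pos|].
  exact (holder_bound_abs _ _ _ _ _ H).
Qed.

Lemma is_derive_continuous (f : R -> R) x l : is_derive f x l -> continuous f x.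
Proof. intros H. apply (ex_derive_continuous (V := R_NormedModule)). now exists l. Qed.

Lemma holder_bound_continuous k theta M f x : holder_bound k theta M f -> continuous f x.
Proof.
  destruct k as [|k]; intros [_ H]; [apply H|].
  destruct H as [f' [H _]]. exact (is_derive_continuous _ _ _ (H x)).
Qed.

Lemma holder_bound_ext k theta M f g :
  (forall x, f x = g x) -> holder_bound k theta M f -> holder_bound k theta M g.
Proof. intros H. now rewrite (functional_extensionality _ _ H). Qed.

Lemma Rpower_gt0 x y : 0 < Rpower x y.
Proof. apply exp_pos. Qed.

Lemma holder_bound_le k theta M N f :
  M <= N -> holder_bound k theta M f -> holder_bound k theta N f.
Proof.
  intros HMN. revert f. induction k as [|k IH]; intros f [Hb H]; split.
  - intros x. specialize (Hb x). lra.
  - destruct H as [Hc Hh]. split; [exact Hc|]. intros x h hh.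
    eapply Rle_trans; [apply Hh, hh|].
    apply Rmult_le_compat_r; [apply Rlt_le, Rpower_gt0|exact HMN].
  - intros x. specialize (Hb x). lra.
  - destruct H as [f' [Hd Hf']]. exists f'. auto.
Qed.

Lemma holder_bound_plus k theta M N f g :
  holder_bound k theta M f -> holder_bound k theta N g ->
  holder_bound k theta (M + N) (fun x => f x + g x).
Proof.
  revert f g. induction k as [|k IH]; intros f g [Hf Hf'] [Hg Hg'].
  - split; [|split].
    + intros x. eapply Rle_trans; [apply Rabs_triang|]. now apply Rplus_le_compat.
    + intros x. apply (continuous_plus (V := R_NormedModule)); [apply Hf'|apply Hg'].
    + intros x h hh. replace (f (x + h) + g (x + h) - (f x + g x))
        with ((f (x + h) - f x) + (g (x + h) - g x)) by ring.
      eapply Rle_trans; [apply Rabs_triang|]. rewrite Rmult_plus_distr_r.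
      apply Rplus_le_compat; [now apply Hf'|now apply Hg'].
  - split.
    + intros x. eapply Rle_trans; [apply Rabs_triang|]. now apply Rplus_le_compat.
    + destruct Hf' as [f' [Df Bf]], Hg' as [g' [Dg Bg]].
      exists (fun x => f' x + g' x). split; [|auto].
      intros x. now apply (is_derive_plus (V := R_NormedModule)).
Qed.

Lemma holder_bound_scal k theta M c f :
  holder_bound k theta M f -> holder_bound k theta (Rabs c * M) (fun x => c * f x).
Proof.
  assert (B : forall a b, Rabs a <= b -> Rabs (c * a) <= Rabs c * b).
  { intros a b H. rewrite Rabs_mult. apply Rmult_le_compat_l; [apply Rabs_pos|exact H]. }
  revert f. induction k as [|k IH]; intros f [Hf Hf']; (split; [intros x; now apply B|]).
  - split.
    + intros x. apply (continuous_scal_r (V := R_NormedModule)). apply Hf'.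
    + intros x h hh. rewrite <- Rmult_minus_distr_l, Rmult_assoc. now apply B, Hf'.
  - destruct Hf' as [f' [Df Bf]]. exists (fun x => c * f' x). split; [|auto].
    intros x. now apply (is_derive_scal f x c).
Qed.

Lemma holder_bound_minus k theta M N f g :
  holder_bound k theta M f -> holder_bound k theta N g ->
  holder_bound k theta (M + N) (fun x => f x - g x).
Proof.
  intros Hf Hg. apply (holder_bound_scal _ _ _ (-1)) in Hg.
  generalize (holder_bound_plus _ _ _ _ _ _ Hf Hg).
  rewrite Rabs_left by lra. replace (- -1 * N) with N by ring.
  apply holder_bound_ext. intros x. ring.
Qed.

Lemma exp_monotone a b : a <= b -> exp a <= exp b.
Proof. intros [H| ->]; [left; now apply exp_increasing|right; reflexivity]. Qed.

Lemma Rpower_small h a b : 0 < h <= 1 -> a <= b -> Rpower h b <= Rpower h a.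
Proof.
  intros [h0 h1] ab. unfold Rpower. apply exp_monotone.
  assert (ln h <= 0). { rewrite <- ln_1. now apply ln_le. }
  nra.
Qed.

Lemma Rpower_large h a : 1 < h -> 0 <= a -> 1 <= Rpower h a.
Proof.
  intros h1 a0. rewrite <- exp_0. unfold Rpower. apply exp_monotone.
  assert (0 < ln h). { rewrite <- ln_1. apply ln_increasing; lra. }
  nra.
Qed.

(** Long increments cost nothing: the difference is at most 2M and |h|^eta is at least 1. This is
    the origin of the factor 2 in the two comparison lemmas below. *)
Lemma holder_increment_large (f : R -> R) M eta x h :
  (forall x, Rabs (f x) <= M) -> 0 <= eta -> 1 < Rabs h ->
  Rabs (f (x + h) - f x) <= 2 * M * Rpower (Rabs h) eta.
Proof.
  intros Hf He Hh.
  assert (H1 := Rpower_large _ _ Hh He).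
  assert (H2 := Hf x). assert (H3 := Hf (x + h)). assert (H4 := Rabs_pos (f x)).
  assert (H5 : Rabs (f (x + h) - f x) <= 2 * M).
  { unfold Rminus. eapply Rle_trans; [apply Rabs_triang|]. rewrite Rabs_Ropp. lra. }
  nra.
Qed.

Lemma holder_bound_exponent k theta eta M f :
  0 <= eta <= theta -> holder_bound k theta M f -> holder_bound k eta (2 * M) f.
Proof.
  intros He. revert f. induction k as [|k IH]; intros f H;
    assert (M0 := holder_bound_ge0 _ _ _ _ H); destruct H as [Hf Hf'];
    (split; [intros x; specialize (Hf x); lra|]).
  - destruct Hf' as [Hc Hh]. split; [exact Hc|]. intros x h hh.
    destruct (Rle_or_lt (Rabs h) 1) as [h1|h1].
    + eapply Rle_trans; [apply Hh, hh|].
      assert (0 < Rabs h) by now apply Rabs_pos_lt.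
      assert (P := Rpower_small (Rabs h) eta theta ltac:(lra) ltac:(lra)).
      assert (Q := Rpower_gt0 (Rabs h) eta). nra.
    + apply holder_increment_large; [exact Hf|lra|exact h1].
  - destruct Hf' as [f' [Df Bf]]. exists f'. auto.
Qed.

(** The mean value inequality bounds the increments of the k-th derivative by M |h|, and |h| <=
    |h|^eta for |h| <= 1. A whole derivative is traded away, so [eta] is free in [0,1],
    independently of [theta]. *)
Lemma holder_bound_lower k theta eta M f :
  0 <= eta <= 1 -> holder_bound (S k) theta M f -> holder_bound k eta (2 * M) f.
Proof.
  intros He. revert f. induction k as [|k IH]; intros f H;
    assert (M0 := holder_bound_ge0 _ _ _ _ H); destruct H as [Hf [f' [Df Bf]]];
    (split; [intros x; specialize (Hf x); lra|]).
  - split; [intros x; exact (is_derive_continuous _ _ _ (Df x))|]. intros x h hh.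
    destruct (Rle_or_lt (Rabs h) 1) as [h1|h1].
    + assert (0 < Rabs h) by now apply Rabs_pos_lt.
      assert (B : Rabs (f (x + h) - f x) <= M * Rabs (x + h - x)).
      { apply bounded_variation with (dh := f'). intros t _. split; [apply Df|apply Bf]. }
      replace (x + h - x) with h in B by ring.
      assert (P := Rpower_small (Rabs h) eta 1 ltac:(lra) ltac:(lra)).
      rewrite Rpower_1 in P by lra. nra.
    + apply holder_increment_large; [exact Hf|lra|exact h1].
  - exists f'. auto.
Qed.

(* Leibniz rule by induction on [k]: each step doubles the number of products and, through
   [holder_bound_lower], the bound on the undifferentiated factor. *)
Lemma holder_bound_mult k theta M N f g :
  0 <= theta <= 1 -> holder_bound k theta M f -> holder_bound k theta N g ->
  holder_bound k theta (2 * 4 ^ k * (M * N)) (fun x => f x * g x).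
Proof.
  intros Ht. revert M N f g. induction k as [|k IH]; intros M N f g Hf Hg;
    assert (M0 := holder_bound_ge0 _ _ _ _ Hf); assert (N0 := holder_bound_ge0 _ _ _ _ Hg);
    assert (MN := Rmult_le_pos _ _ M0 N0);
    (assert (B : forall x, Rabs (f x * g x) <= M * N);
      [intros x; rewrite Rabs_mult; apply Rmult_le_compat; try apply Rabs_pos;
       eapply holder_bound_abs; eassumption|]).
  - split; [intros x; specialize (B x); simpl; lra|].
    destruct Hf as [Bf [Cf Hf]], Hg as [Bg [Cg Hg]]. split.
    + intros x. apply (continuous_mult (K := R_AbsRing)); auto.
    + intros x h hh.
      replace (f (x + h) * g (x + h) - f x * g x)
        with ((f (x + h) - f x) * g (x + h) + f x * (g (x + h) - g x)) by ring.
      eapply Rle_trans; [apply Rabs_triang|]. rewrite !Rabs_mult.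
      apply Rle_trans with
        (M * Rpower (Rabs h) theta * N + M * (N * Rpower (Rabs h) theta)); [|simpl; lra].
      apply Rplus_le_compat; apply Rmult_le_compat; auto using Rabs_pos.
  - assert (C1 : 1 <= 4 ^ k) by (apply pow_R1_Rle; lra).
    split; [intros x; specialize (B x); simpl; nra|].
    assert (Lf := holder_bound_lower _ _ theta _ _ Ht Hf).
    assert (Lg := holder_bound_lower _ _ theta _ _ Ht Hg).
    destruct Hf as [Bf [f' [Df Hf']]], Hg as [Bg [g' [Dg Hg']]].
    exists (fun x => f' x * g x + f x * g' x). split.
    + intros x. apply (is_derive_mult (K := R_AbsRing) f g x); auto. intros; apply Rmult_comm.
    + replace (2 * 4 ^ S k * (M * N))
        with (2 * 4 ^ k * (M * (2 * N)) + 2 * 4 ^ k * (2 * M * N)) by (simpl; ring).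
      apply holder_bound_plus; auto.
Qed.

Lemma holder_bound_Derive k theta M f :
  holder_bound (S k) theta M f ->
  (forall x, is_derive f x (Derive f x)) /\ holder_bound k theta M (Derive f).
Proof.
  intros [_ [f' [Df Hf']]].
  assert (E : forall x, f' x = Derive f x) by (intros x; symmetry; now apply is_derive_unique).
  split; [intros x; rewrite <- E; apply Df|].
  now apply holder_bound_ext with f'.
Qed.

(** * Hölder bounds and the Hölder norm *)

Lemma sup_norm_le f (M : R) : Rbar_le (sup_norm f) M <-> forall x, Rabs (f x) <= M.
Proof.
  unfold sup_norm. destruct (Lub_Rbar_correct (fun r => exists x, r = Rabs (f x))) as [U L].
  split.
  - intros H x. apply (Rbar_le_trans (Rabs (f x)) _ M) in H; [exact H|]. apply U. now exists x.
  - intros H. apply L. intros r [x ->]. apply H.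
Qed.

Lemma sup_norm_ge0 f : Rbar_le 0 (sup_norm f).
Proof.
  destruct (Lub_Rbar_correct (fun r => exists x, r = Rabs (f x))) as [U _].
  apply Rbar_le_trans with (Rabs (f 0)); [apply Rabs_pos|]. apply U. now exists 0.
Qed.

Lemma holder_quotient_le theta a h M :
  Rabs (Rpower (Rabs h) (- theta) * a) <= M <-> Rabs a <= M * Rpower (Rabs h) theta.
Proof.
  assert (P := Rpower_gt0 (Rabs h) theta).
  rewrite Rabs_mult, Rpower_Ropp, (Rabs_right (/ _)) by (left; now apply Rinv_0_lt_compat).
  rewrite Rmult_comm. split; intros H.
  - apply Rmult_le_reg_r with (/ Rpower (Rabs h) theta); [now apply Rinv_0_lt_compat|].
    rewrite Rmult_assoc, Rinv_r by lra. lra.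
  - apply Rmult_le_reg_r with (Rpower (Rabs h) theta); [exact P|].
    rewrite Rmult_assoc, Rinv_l by lra. lra.
Qed.

Lemma holder_seminorm_le theta g (M : R) :
  Rbar_le (holder_seminorm theta g) M <->
  forall x h, h <> 0 -> Rabs (g (x + h) - g x) <= M * Rpower (Rabs h) theta.
Proof.
  unfold holder_seminorm, Rbar_lub. destruct (Rbar_ex_lub _) as [l [U L]]; simpl proj1_sig.
  split.
  - intros H x h hh. apply holder_quotient_le.
    apply (sup_norm_le (fun x => Rpower (Rabs h) (- theta) * (g (x + h) - g x))).
    apply Rbar_le_trans with l; [|exact H]. apply U. now exists h.
  - intros H. apply L. intros s [h [hh ->]]. apply sup_norm_le. intros x.
    now apply holder_quotient_le, H.
Qed.

Lemma holder_seminorm_ge0 theta g : Rbar_le 0 (holder_seminorm theta g).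
Proof.
  unfold holder_seminorm, Rbar_lub. destruct (Rbar_ex_lub _) as [l [U L]]; simpl proj1_sig.
  apply Rbar_le_trans with (1 := sup_norm_ge0 (fun x => Rpower (Rabs 1) (- theta) * (g (x + 1) - g x))).
  apply U. exists 1. split; [lra|reflexivity].
Qed.

Lemma Rbar_plus_ge0 a b : Rbar_le 0 a -> Rbar_le 0 b ->
  Rbar_le 0 (Rbar_plus a b) /\ Rbar_le a (Rbar_plus a b) /\ Rbar_le b (Rbar_plus a b).
Proof. destruct a, b; simpl; try tauto; intros; repeat split; lra. Qed.

Lemma Rbar_sum_ge (a : nat -> Rbar) n : (forall i, Rbar_le 0 (a i)) ->
  Rbar_le 0 (Rbar_sum a n) /\ forall i, (i <= n)%nat -> Rbar_le (a i) (Rbar_sum a n).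
Proof.
  intros Ha. induction n as [|n [IH0 IH]]; simpl.
  - split; [apply Ha|]. intros i Hi. replace i with 0%nat by lia. apply Rbar_le_refl.
  - destruct (Rbar_plus_ge0 _ _ IH0 (Ha (S n))) as [P0 [P1 P2]]. split; [exact P0|].
    intros i Hi. destruct (Nat.eq_dec i (S n)) as [->|Hn]; [exact P2|].
    eapply Rbar_le_trans; [apply IH; lia|exact P1].
Qed.

Lemma Rbar_sum_le_const (a : nat -> Rbar) n (M : R) :
  (forall i, (i <= n)%nat -> Rbar_le (a i) M) -> Rbar_le (Rbar_sum a n) (INR (S n) * M).
Proof.
  induction n as [|n IH]; intros Ha.
  - simpl Rbar_sum. replace (INR 1 * M) with M by (simpl; ring). now apply Ha.
  - replace (Finite (INR (S (S n)) * M)) with (Rbar_plus (INR (S n) * M) M)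
      by (rewrite (S_INR (S n)); simpl; f_equal; ring).
    simpl Rbar_sum. apply Rbar_plus_le_compat; [apply IH; auto|apply Ha; lia].
Qed.

Lemma holder_norm_le_elim k theta f (M : R) : Rbar_le (holder_norm k theta f) M ->
  (forall i, (i <= k)%nat -> forall x, Rabs (Derive_n f i x) <= M) /\
  (forall x h, h <> 0 ->
     Rabs (Derive_n f k (x + h) - Derive_n f k x) <= M * Rpower (Rabs h) theta).
Proof.
  intros H.
  destruct (Rbar_sum_ge (fun i => sup_norm (Derive_n f i)) k) as [S0 Si];
    [intros; apply sup_norm_ge0|].
  destruct (Rbar_plus_ge0 _ _ S0 (holder_seminorm_ge0 theta (Derive_n f k))) as [_ [P1 P2]].
  split.
  - intros i Hi. apply sup_norm_le. eapply Rbar_le_trans; [apply (Si i Hi)|].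
    eapply Rbar_le_trans; [exact P1|exact H].
  - apply holder_seminorm_le. eapply Rbar_le_trans; [exact P2|exact H].
Qed.

(** The k+1 sup norms and the seminorm are each at most M, so the norm is at most (k+2) M;
    nonnegativity excludes the value minus infinity. *)
Lemma holder_norm_finite k theta f (M : R) :
  (forall i, (i <= k)%nat -> forall x, Rabs (Derive_n f i x) <= M) ->
  (forall x h, h <> 0 ->
     Rabs (Derive_n f k (x + h) - Derive_n f k x) <= M * Rpower (Rabs h) theta) ->
  is_finite (holder_norm k theta f).
Proof.
  intros H1 H2.
  destruct (Rbar_sum_ge (fun i => sup_norm (Derive_n f i)) k) as [S0 _];
    [intros; apply sup_norm_ge0|].
  destruct (Rbar_plus_ge0 _ _ S0 (holder_seminorm_ge0 theta (Derive_n f k))) as [P0 _].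
  apply is_finite_correct.
  assert (U : Rbar_le (holder_norm k theta f) (Rbar_plus (INR (S k) * M) M)).
  { apply Rbar_plus_le_compat; [|now apply holder_seminorm_le].
    apply Rbar_sum_le_const. intros i Hi. now apply sup_norm_le, H1. }
  unfold holder_norm in *. destruct (Rbar_plus _ (holder_seminorm _ _)) as [r| |].
  - now exists r.
  - now destruct U.
  - now destruct P0.
Qed.

Lemma Derive_n_Derive f i x : Derive_n (Derive f) i x = Derive_n f (S i) x.
Proof. change (Derive f) with (Derive_n f 1). rewrite Derive_n_comp. f_equal. lia. Qed.

Lemma ex_derive_n_Derive f i x : ex_derive_n f (S (S i)) x <-> ex_derive_n (Derive f) (S i) x.
Proof.
  simpl. split; apply ex_derive_ext; intros y;
    [symmetry|]; apply (Derive_n_Derive f i y).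
Qed.

Lemma class_C_S k f :
  class_C (S k) f <-> (forall x, ex_derive f x) /\ class_C k (Derive f).
Proof.
  assert (E : Derive_n (Derive f) k = Derive_n f (S k)).
  { apply functional_extensionality. intros x. apply Derive_n_Derive. }
  unfold class_C. rewrite E. split.
  - intros [Hd Hc]. split; [|split; [|exact Hc]].
    + intros x. apply (Hd 1%nat x). lia.
    + intros [|i] x Hi; [exact I|]. apply (proj1 (ex_derive_n_Derive f i x)).
      apply (Hd (S (S i)) x). lia.
  - intros [H1 [Hd Hc]]. split; [|exact Hc].
    intros [|[|i]] x Hi; [exact I|apply H1|].
    apply (proj2 (ex_derive_n_Derive f i x)). apply (Hd (S i) x). lia.
Qed.

Lemma holder_bound_iff k theta M f : holder_bound k theta M f <->
  class_C k f /\ (forall i, (i <= k)%nat -> forall x, Rabs (Derive_n f i x) <= M) /\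
  (forall x h, h <> 0 ->
     Rabs (Derive_n f k (x + h) - Derive_n f k x) <= M * Rpower (Rabs h) theta).
Proof.
  revert f. induction k as [|k IH]; intros f.
  - split.
    + intros [Hb [Hc Hh]]. split; [split|split; [|exact Hh]].
      * intros i x Hi. replace i with 0%nat by lia. exact I.
      * exact Hc.
      * intros i Hi. replace i with 0%nat by lia. exact Hb.
    + intros [[_ Hc] [Hb Hh]]. split; [exact (Hb 0%nat (Nat.le_refl _))|]. now split.
  - assert (E : forall i, Derive_n (Derive f) i = Derive_n f (S i)).
    { intros i. apply functional_extensionality. intros x. apply Derive_n_Derive. }
    rewrite class_C_S. split.
    + intros H. assert (Hb := fun x => holder_bound_abs _ _ _ _ x H).
      apply holder_bound_Derive in H. destruct H as [Hd H].
      apply IH in H. destruct H as [Hc [Hi Hh]]. rewrite E in Hh.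
      split; [split; [intros x; eexists; apply Hd|exact Hc]|split; [|exact Hh]].
      intros [|i] Hik; [exact Hb|]. rewrite <- E. apply Hi. lia.
    + intros [[H1 Hc] [Hi Hh]]. split; [exact (Hi 0%nat (Nat.le_0_l _))|].
      exists (Derive f). split; [intros x; now apply Derive_correct|].
      apply IH. split; [exact Hc|split].
      * intros i Hik. rewrite E. apply Hi. lia.
      * rewrite E. exact Hh.
Qed.

Lemma holder_bound_of_norm k theta f (M : R) :
  class_C k f -> Rbar_le (holder_norm k theta f) M -> holder_bound k theta M f.
Proof. intros Hc H. apply holder_bound_iff. split; [exact Hc|now apply holder_norm_le_elim]. Qed.

Lemma holder_space_iff k theta f :
  holder_space k theta f <-> exists M, holder_bound k theta M f.
Proof.
  split.
  - intros [Hc [_ Hf]]. exists (real (holder_norm k theta f)).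
    apply holder_bound_of_norm; [exact Hc|]. rewrite Hf. apply Rbar_le_refl.
  - intros [M H]. apply holder_bound_iff in H. destruct H as [Hc [Hi Hh]].
    split; [exact Hc|split].
    + intros i Hik. exists M. now apply Hi.
    + now apply holder_norm_finite with M.
Qed.

(** * Time-dependent families and their time integrals *)

(** The exponential averages are controlled in sup norm only. Uniformity in x makes such curves
    jointly continuous, which is what time integration and differentiation under the integral sign
    require. Time ranges over all of R to avoid endpoint cases; [clamp] later brings solutions into
    this setting. *)
Definition sup_curve (g : R -> R -> R) : Prop :=
  (forall t x, continuous (g t) x) /\
  (forall t (eps : posreal), exists delta : posreal,
     forall s, Rabs (s - t) < delta -> forall x, Rabs (g s x - g t x) <= eps).

Definition holder_curve (k : nat) (theta : R) (g : R -> R -> R) : Prop :=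
  (forall t, exists M, holder_bound k theta M (g t)) /\
  (forall t (eps : posreal), exists delta : posreal,
     forall s, Rabs (s - t) < delta -> holder_bound k theta eps (fun x => g s x - g t x)).

Lemma holder_curve_sup k theta g : holder_curve k theta g -> sup_curve g.
Proof.
  intros [H1 H2]. split.
  - intros t x. destruct (H1 t) as [M H]. exact (holder_bound_continuous _ _ _ _ _ H).
  - intros t eps. destruct (H2 t eps) as [d H]. exists d. intros s Hs x.
    exact (holder_bound_abs _ _ _ _ x (H s Hs)).
Qed.

Lemma holder_curve_Derive k theta g :
  holder_curve (S k) theta g -> holder_curve k theta (fun t => Derive (g t)).
Proof.
  intros [H1 H2]. split.
  - intros t. destruct (H1 t) as [M H]. exists M. now apply holder_bound_Derive.
  - intros t eps. destruct (H2 t eps) as [d H]. exists d. intros s Hs.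
    destruct (holder_bound_Derive _ _ _ _ (H s Hs)) as [_ B].
    revert B. apply holder_bound_ext. intros x.
    destruct (H1 s) as [Ms Hs']. destruct (H1 t) as [Mt Ht'].
    apply Derive_minus; eexists; eapply holder_bound_Derive; eassumption.
Qed.

(** Time is moved first, at the displaced point [y], where uniformity in space controls the change;
    then continuity of the single function [g t] suffices. *)
Lemma sup_curve_continuity_2d g x t :
  sup_curve g -> continuity_2d_pt (fun x t => g t x) x t.
Proof.
  intros [Hc Ht] eps.
  destruct (Ht t (pos_div_2 eps)) as [d1 H1].
  assert (H2 := proj1 (filterlim_locally (g t) (g t x)) (Hc t x) (pos_div_2 eps)).
  destruct H2 as [d2 H2].
  assert (dp : 0 < Rmin d1 d2) by (apply Rmin_pos; apply cond_pos).
  exists (mkposreal _ dp). simpl. intros y s Hy Hs.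
  assert (A1 := H1 s (Rlt_le_trans _ _ _ Hs (Rmin_l _ _)) y).
  assert (A2 : Rabs (g t y - g t x) < eps / 2).
  { apply H2. exact (Rlt_le_trans _ _ _ Hy (Rmin_r _ _)). }
  simpl in A1. replace (g s y - g t x) with ((g s y - g t y) + (g t y - g t x)) by ring.
  eapply Rle_lt_trans; [apply Rabs_triang|]. lra.
Qed.

Lemma sup_curve_continuous_time g x t : sup_curve g -> continuous (fun t => g t x) t.
Proof.
  intros [_ H]. apply filterlim_locally. intros eps.
  destruct (H t (pos_div_2 eps)) as [d Hd]. exists d. intros s Hs.
  apply Rle_lt_trans with (eps / 2); [exact (Hd s Hs x)|].
  assert (E := cond_pos eps). lra.
Qed.

Lemma sup_curve_ex_RInt g a b x : sup_curve g -> ex_RInt (fun t => g t x) a b.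
Proof.
  intros H. apply (ex_RInt_continuous (V := R_CompleteNormedModule)).
  intros t _. now apply sup_curve_continuous_time.
Qed.

Lemma sup_curve_minus f g :
  sup_curve f -> sup_curve g -> sup_curve (fun t x => f t x - g t x).
Proof.
  intros [Hf1 Hf2] [Hg1 Hg2]. split.
  - intros t x. apply (continuous_minus (V := R_NormedModule)); auto.
  - intros t eps.
    destruct (Hf2 t (pos_div_2 eps)) as [d1 H1], (Hg2 t (pos_div_2 eps)) as [d2 H2].
    assert (dp : 0 < Rmin d1 d2) by (apply Rmin_pos; apply cond_pos).
    exists (mkposreal _ dp). simpl. intros s Hs x.
    assert (A1 := H1 s (Rlt_le_trans _ _ _ Hs (Rmin_l _ _)) x).
    assert (A2 := H2 s (Rlt_le_trans _ _ _ Hs (Rmin_r _ _)) x).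
    simpl in A1, A2.
    replace (f s x - g s x - (f t x - g t x)) with ((f s x - f t x) - (g s x - g t x)) by ring.
    unfold Rminus at 1. eapply Rle_trans; [apply Rabs_triang|]. rewrite Rabs_Ropp. lra.
Qed.

Lemma sup_curve_reflect f : sup_curve f -> sup_curve (fun t x => f t (- x)).
Proof.
  intros [H1 H2]. split.
  - intros t x. apply (continuous_comp Ropp (f t)); [|apply H1].
    apply (continuous_opp (V := R_NormedModule)), continuous_id.
  - intros t eps. destruct (H2 t eps) as [d H]. exists d. auto.
Qed.

Lemma Rabs_RInt_le f a b M : ex_RInt f a b ->
  (forall t, Rmin a b <= t <= Rmax a b -> Rabs (f t) <= M) ->
  Rabs (RInt f a b) <= M * Rabs (b - a).
Proof.
  intros Hf HM. destruct (Rle_or_lt a b) as [h|h].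
  - rewrite Rmin_left, Rmax_right in HM by lra.
    rewrite (Rabs_right (b - a)), Rmult_comm by lra. now apply abs_RInt_le_const.
  - rewrite Rmin_right, Rmax_left in HM by lra.
    rewrite <- (opp_RInt_swap (V := R_CompleteNormedModule)) by now apply ex_RInt_swap.
    change (Rabs (- RInt f b a) <= M * Rabs (b - a)). rewrite Rabs_Ropp.
    rewrite (Rabs_left (b - a)) by lra. replace (M * - (b - a)) with ((a - b) * M) by ring.
    apply abs_RInt_le_const; [lra|now apply ex_RInt_swap|exact HM].
Qed.

Lemma RInt_minus_R f g a b : ex_RInt f a b -> ex_RInt g a b ->
  RInt (fun t => f t - g t) a b = RInt f a b - RInt g a b.
Proof. exact (RInt_minus (V := R_CompleteNormedModule) f g a b). Qed.

Lemma RInt_scal_R f a b c : ex_RInt f a b -> RInt (fun t => c * f t) a b = c * RInt f a b.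
Proof. exact (RInt_scal (V := R_CompleteNormedModule) f a b c). Qed.

Lemma continuous_RInt_curve g a b x :
  sup_curve g -> continuous (fun x => RInt (fun t => g t x) a b) x.
Proof.
  intros H. apply filterlim_locally. intros eps.
  (* The added 1 keeps the denominator positive when a = b and makes the final inequality strict. *)
  assert (ep : 0 < eps / (Rabs (b - a) + 1)).
  { assert (A := Rabs_pos (b - a)). apply Rdiv_lt_0_compat; [apply cond_pos|lra]. }
  destruct (uniform_continuity_2d_1d' (fun x t => g t x) (Rmin a b) (Rmax a b) x
    (fun t _ => sup_curve_continuity_2d _ _ _ H) (mkposreal _ ep)) as [d Hd].
  exists d. intros y Hy. change (Rabs (y - x) < d) in Hy.
  apply Rabs_lt_between in Hy. assert (dp := cond_pos d).
  change (Rabs (RInt (fun t => g t y) a b - RInt (fun t => g t x) a b) < eps).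
  rewrite <- RInt_minus_R by now apply sup_curve_ex_RInt.
  eapply Rle_lt_trans; [apply (Rabs_RInt_le _ a b (eps / (Rabs (b - a) + 1)))|].
  - apply (ex_RInt_minus (V := R_NormedModule)); now apply sup_curve_ex_RInt.
  - intros t Ht. left. apply (Hd t x t y); try lra.
    rewrite Rminus_diag, Rabs_R0. exact dp.
  - assert (A := Rabs_pos (b - a)). assert (E := cond_pos eps).
    apply Rmult_lt_reg_r with (Rabs (b - a) + 1); [lra|].
    replace (eps / (Rabs (b - a) + 1) * Rabs (b - a) * (Rabs (b - a) + 1))
      with (eps * Rabs (b - a)) by (field; lra). lra.
Qed.

Lemma is_derive_RInt_curve f f' a b x :
  sup_curve f -> sup_curve f' -> (forall t x, is_derive (f t) x (f' t x)) ->
  is_derive (fun x => RInt (fun t => f t x) a b) x (RInt (fun t => f' t x) a b).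
Proof.
  intros Hf Hf' Hd.
  assert (E : forall t x, Derive (fun z => f t z) x = f' t x).
  { intros t y. now apply is_derive_unique. }
  rewrite <- (RInt_ext (fun t => Derive (fun u => f t u) x)) by (intros; apply E).
  apply (is_derive_RInt_param (fun x t => f t x)).
  - apply filter_forall. intros y t _. eexists. apply Hd.
  - intros t _. apply continuity_2d_pt_ext with (fun x t => f' t x); [intros; now rewrite E|].
    now apply sup_curve_continuity_2d.
  - apply filter_forall. intros y. now apply sup_curve_ex_RInt.
Qed.

(** Every clause of [holder_bound] survives integration because M is uniform in t; the derivative
    passes under the integral sign since the curve of derivatives is again a Hölder curve, of order
    one lower. *)
Lemma holder_bound_RInt k theta M g a b :
  holder_curve k theta g ->
  (forall t, Rmin a b <= t <= Rmax a b -> holder_bound k theta M (g t)) ->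
  holder_bound k theta (M * Rabs (b - a)) (fun x => RInt (fun t => g t x) a b).
Proof.
  revert g. induction k as [|k IH]; intros g Hg HM; assert (Hs := holder_curve_sup _ _ _ Hg);
    (split; [intros x; apply Rabs_RInt_le; [now apply sup_curve_ex_RInt|];
             intros t Ht; exact (holder_bound_abs _ _ _ _ x (HM t Ht))|]).
  - split; [intros x; now apply continuous_RInt_curve|]. intros x h hh.
    rewrite <- RInt_minus_R by now apply sup_curve_ex_RInt.
    replace (M * Rabs (b - a) * Rpower (Rabs h) theta)
      with (M * Rpower (Rabs h) theta * Rabs (b - a)) by ring.
    apply Rabs_RInt_le.
    + apply (ex_RInt_minus (V := R_NormedModule)); now apply sup_curve_ex_RInt.
    + intros t Ht. now apply (HM t Ht).
  - exists (fun x => RInt (fun t => Derive (g t) x) a b).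
    assert (Hd := holder_curve_Derive _ _ _ Hg). split.
    + intros x. apply (is_derive_RInt_curve g (fun t => Derive (g t))); [exact Hs|exact (holder_curve_sup _ _ _ Hd)|].
      intros t y. destruct (proj1 Hg t) as [Mt Ht]. now apply (holder_bound_Derive _ _ _ _ Ht).
    + apply IH; [exact Hd|]. intros t Ht. now apply holder_bound_Derive, HM.
Qed.

Lemma holder_curve_near k theta g t : holder_curve k theta g ->
  exists (M : R) (delta : posreal), forall s, Rabs (s - t) < delta -> holder_bound k theta M (g s).
Proof.
  intros [H1 H2]. destruct (H1 t) as [M HM]. destruct (H2 t (mkposreal 1 Rlt_0_1)) as [d Hd].
  exists (M + 1), d. intros s Hs.
  generalize (holder_bound_plus _ _ _ _ _ _ HM (Hd s Hs)).
  apply holder_bound_ext. intros x. ring.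
Qed.

Lemma holder_curve_bounded k theta g a b : holder_curve k theta g ->
  exists M, forall t, a <= t <= b -> holder_bound k theta M (g t).
Proof.
  intros H.
  (* Compactness only provides a lower bound on the radii, so the radius chosen at [t]
     also encodes the bound available around [t]. *)
  assert (L : forall t, exists d : posreal,
    forall s, Rabs (s - t) < d -> holder_bound k theta (/ d) (g s)).
  { intros t. destruct (holder_curve_near _ _ _ t H) as [M [d Hd]].
    assert (A := Rle_abs M). assert (A0 := Rabs_pos M).
    assert (ip : 0 < / (Rabs M + 1)) by (apply Rinv_0_lt_compat; lra).
    assert (dp : 0 < Rmin d (/ (Rabs M + 1))) by (apply Rmin_pos; [apply cond_pos|exact ip]).
    exists (mkposreal _ dp). simpl. intros s Hs.
    apply holder_bound_le with M.
    - apply Rle_trans with (/ / (Rabs M + 1)); [rewrite Rinv_inv; lra|].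
      apply Rinv_le_contravar; [exact dp|apply Rmin_r].
    - apply Hd. exact (Rlt_le_trans _ _ _ Hs (Rmin_l _ _)). }
  set (r := fun t => proj1_sig (constructive_indefinite_description _ (L t))).
  destruct (compactness_value_1d a b r) as [d Hd]. exists (/ d). intros s Hs.
  destruct (NNPP _ (Hd s Hs)) as [t [_ [Ht Hdt]]].
  apply holder_bound_le with (/ r t); [apply Rinv_le_contravar; [apply cond_pos|exact Hdt]|].
  exact (proj2_sig (constructive_indefinite_description _ (L t)) s Ht).
Qed.

(** Continuity in time rests on the factorisation g(s) - g(t) = D + (u(s) + u(t)) D / 2 with D =
    u(s) - u(t), and on the algebra property. *)
Lemma holder_curve_flux k theta u : 0 <= theta <= 1 -> holder_curve k theta u ->
  holder_curve k theta (fun t x => u t x + (u t x) ^ 2 / 2).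
Proof.
  intros Ht Hu. destruct (Hu) as [H1 H2]. split.
  - intros t. destruct (H1 t) as [M HM]. eexists.
    refine (holder_bound_ext _ _ _ _ _ _ (holder_bound_plus _ _ _ _ _ _ HM
      (holder_bound_scal _ _ _ (/ 2) _ (holder_bound_mult _ _ _ _ _ _ Ht HM HM)))).
    intros x. simpl. field.
  - intros t eps. destruct (holder_curve_near _ _ _ t Hu) as [M [d1 Hd1]].
    assert (M0 : 0 <= M).
    { apply (holder_bound_ge0 k theta M (u t)), Hd1.
      rewrite Rminus_diag, Rabs_R0. apply cond_pos. }
    assert (C0 : 0 < 4 ^ k) by (apply pow_lt; lra).
    (* Local Lipschitz constant of the flux: 1 from the linear part, the rest from
       [holder_bound_mult] applied to u(s) + u(t), bounded by M + M, and D. *)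
    set (C := 1 + / 2 * (2 * 4 ^ k * (M + M))).
    assert (Cp : 0 < C) by (unfold C; nra).
    assert (ep : 0 < eps / C) by (apply Rdiv_lt_0_compat; [apply cond_pos|exact Cp]).
    destruct (H2 t (mkposreal _ ep)) as [d2 Hd2]. simpl in Hd2.
    assert (dp : 0 < Rmin d1 d2) by (apply Rmin_pos; apply cond_pos).
    exists (mkposreal _ dp). simpl. intros s Hs.
    assert (D := Hd2 s (Rlt_le_trans _ _ _ Hs (Rmin_r _ _))).
    assert (Bs := Hd1 s (Rlt_le_trans _ _ _ Hs (Rmin_l _ _))).
    assert (Bt : holder_bound k theta M (u t)).
    { apply Hd1. rewrite Rminus_diag, Rabs_R0. apply cond_pos. }
    assert (S := holder_bound_plus _ _ _ _ _ _ Bs Bt).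
    assert (P := holder_bound_plus _ _ _ _ _ _ D
      (holder_bound_scal _ _ _ (/ 2) _ (holder_bound_mult _ _ _ _ _ _ Ht S D))).
    replace (pos eps) with
      (eps / C + Rabs (/ 2) * (2 * 4 ^ k * ((M + M) * (eps / C)))).
    + revert P. apply holder_bound_ext. intros x. simpl. field.
    + rewrite Rabs_right by lra. transitivity (C * (eps / C)); [unfold C; ring|field; lra].
Qed.

(** * The kernel [K] through one-sided exponential averages *)

(* [exp_tail g x] is the integral of [exp (x - y) * g y] over [y > x]; the formula below makes
   [exp_tail g ' = exp_tail g - g] immediate. *)
Definition exp_tail (g : R -> R) (x : R) : R :=
  exp x * (real (Lim (fun b => RInt (fun y => exp (- y) * g y) 0 b) p_infty) -
           RInt (fun y => exp (- y) * g y) 0 x).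

Lemma continuous_exp_weight (g : R -> R) x : (forall x, continuous g x) ->
  continuous (fun y => exp (- y) * g y) x.
Proof.
  intros H. apply (continuous_mult (K := R_AbsRing)); [|apply H].
  apply (is_derive_continuous _ _ (- exp (- x))). auto_derive; [exact I|ring].
Qed.

Lemma ex_RInt_exp_weight (g : R -> R) a b : (forall x, continuous g x) ->
  ex_RInt (fun y => exp (- y) * g y) a b.
Proof.
  intros H. apply (ex_RInt_continuous (V := R_CompleteNormedModule)).
  intros; now apply continuous_exp_weight.
Qed.

Lemma RInt_exp_weight_le g M a b : (forall x, continuous g x) -> (forall x, Rabs (g x) <= M) ->
  a <= b -> Rabs (RInt (fun y => exp (- y) * g y) 0 b - RInt (fun y => exp (- y) * g y) 0 a)
            <= M * exp (- a).
Proof.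
  intros Hc HM ab.
  assert (M0 : 0 <= M) by (apply Rle_trans with (Rabs (g 0)); [apply Rabs_pos|apply HM]).
  assert (E : RInt (fun y => exp (- y) * g y) 0 b - RInt (fun y => exp (- y) * g y) 0 a
              = RInt (fun y => exp (- y) * g y) a b).
  { rewrite <- (RInt_Chasles (V := R_CompleteNormedModule) _ 0 a b)
      by now apply ex_RInt_exp_weight.
    change plus with Rplus. simpl. ring. }
  rewrite E. apply Rle_trans with (M * exp (- a) - M * exp (- b));
    [|assert (P := exp_pos (- b)); nra].
  apply (norm_RInt_le (V := R_NormedModule) (fun y => exp (- y) * g y)
           (fun y => M * exp (- y)) a b); [exact ab| | |].
  - intros x _. change (Rabs (exp (- x) * g x) <= M * exp (- x)).
    rewrite Rabs_mult, (Rabs_right (exp _)) by (left; apply exp_pos).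
    rewrite Rmult_comm. apply Rmult_le_compat_r; [left; apply exp_pos|apply HM].
  - apply (RInt_correct (V := R_CompleteNormedModule)). now apply ex_RInt_exp_weight.
  - replace (M * exp (- a) - M * exp (- b))
      with (minus (- M * exp (- b)) (- M * exp (- a))) by (unfold minus, plus, opp; simpl; ring).
    apply (is_RInt_derive (V := R_CompleteNormedModule) (fun y => - M * exp (- y))).
    + intros x _. auto_derive; [exact I|ring].
    + intros x _. apply (is_derive_continuous _ _ (- M * exp (- x))).
      auto_derive; [exact I|ring].
Qed.

(** Shows that the limit inside [exp_tail] is finite, so that taking [real] of it is harmless. The
    Cauchy criterion applies because the tail beyond a is at most M exp(-a). *)
Lemma is_lim_exp_weight g M : (forall x, continuous g x) -> (forall x, Rabs (g x) <= M) ->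
  is_lim (fun b => RInt (fun y => exp (- y) * g y) 0 b) p_infty
         (real (Lim (fun b => RInt (fun y => exp (- y) * g y) 0 b) p_infty)).
Proof.
  intros Hc HM.
  assert (M0 : 0 <= M) by (apply Rle_trans with (Rabs (g 0)); [apply Rabs_pos|apply HM]).
  set (I := fun b => RInt (fun y => exp (- y) * g y) 0 b).
  assert (C : exists l : R, is_lim I p_infty l).
  { apply (filterlim_locally_cauchy (U := R_CompleteSpace) (F := Rbar_locally p_infty) I).
    intros eps. assert (E := cond_pos eps).
    (* From exp A >= 1 + A follows M = A eps < eps exp A, that is M exp(-A) < eps. *)
    set (A := M / eps).
    assert (A0 : 0 <= A) by (apply Rdiv_le_0_compat; lra).
    assert (small : M * exp (- A) < eps).
    { rewrite exp_Ropp. assert (X := exp_ineq1_le A). assert (XP := exp_pos A).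
      apply Rmult_lt_reg_r with (exp A); [exact XP|].
      rewrite Rmult_assoc, Rinv_l by lra.
      assert (M = A * eps) by (unfold A; field; lra). nra. }
    assert (W : forall u v, A < u -> u <= v -> Rabs (I v - I u) < eps).
    { intros u v Hu Huv. eapply Rle_lt_trans; [now apply (RInt_exp_weight_le g M u v)|].
      assert (exp (- u) <= exp (- A)) by (apply exp_monotone; lra). nra. }
    exists (fun b => A < b). split; [now exists A|]. intros u v Hu Hv.
    change (Rabs (I v - I u) < eps).
    destruct (Rle_or_lt u v); [|rewrite Rabs_minus_sym]; apply W; lra. }
  destruct C as [l Hl]. rewrite (is_lim_unique _ _ _ Hl). exact Hl.
Qed.

(** The weight exp(x - y) has total mass 1 on y > x, so [exp_tail g x] is an average of g. The bound
    is that of [RInt_exp_weight_le] with a = x, passed to the limit in b by contradiction. *)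
Lemma exp_tail_le g M x : (forall x, continuous g x) -> (forall x, Rabs (g x) <= M) ->
  Rabs (exp_tail g x) <= M.
Proof.
  intros Hc HM. assert (L := is_lim_exp_weight g M Hc HM). unfold exp_tail.
  set (I := fun b => RInt (fun y => exp (- y) * g y) 0 b) in *.
  change (Rabs (exp x * (real (Lim I p_infty) - I x)) <= M).
  set (l := real (Lim I p_infty)) in *.
  assert (B : Rabs (l - I x) <= M * exp (- x)).
  { apply Rnot_lt_le. intros Hlt.
    assert (ep : 0 < Rabs (l - I x) - M * exp (- x)) by lra.
    destruct (proj1 (filterlim_locally I l) L (mkposreal _ ep)) as [A HA].
    set (b := Rmax (A + 1) x).
    assert (H1 : A < b) by (unfold b; assert (Q := Rmax_l (A + 1) x); lra).
    assert (H2 : x <= b) by apply Rmax_r.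
    assert (H3 := HA b H1). change (Rabs (I b - l) < Rabs (l - I x) - M * exp (- x)) in H3.
    assert (H4 : Rabs (I b - I x) <= M * exp (- x)) by now apply RInt_exp_weight_le.
    assert (H5 : Rabs (l - I x) <= Rabs (I b - l) + Rabs (I b - I x)).
    { rewrite (Rabs_minus_sym (I b) l).
      replace (l - I x) with ((l - I b) + (I b - I x)) by ring. apply Rabs_triang. }
    lra. }
  assert (P := exp_pos x).
  rewrite Rabs_mult, (Rabs_right (exp x)) by lra.
  replace M with (exp x * (M * exp (- x))); [apply Rmult_le_compat_l; lra|].
  rewrite exp_Ropp. field. lra.
Qed.

Lemma exp_tail_minus f g M N x :
  (forall x, continuous f x) -> (forall x, Rabs (f x) <= M) ->
  (forall x, continuous g x) -> (forall x, Rabs (g x) <= N) ->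
  exp_tail (fun x => f x - g x) x = exp_tail f x - exp_tail g x.
Proof.
  intros Cf Hf Cg Hg.
  assert (E : forall b, RInt (fun y => exp (- y) * (f y - g y)) 0 b =
    RInt (fun y => exp (- y) * f y) 0 b - RInt (fun y => exp (- y) * g y) 0 b).
  { intros b. rewrite <- RInt_minus_R by now apply ex_RInt_exp_weight.
    apply RInt_ext. intros y _. apply Rmult_minus_distr_l. }
  unfold exp_tail. rewrite E, (functional_extensionality _ _ E).
  rewrite (is_lim_unique _ _ _ (is_lim_minus' _ _ _ _ _
    (is_lim_exp_weight f M Cf Hf) (is_lim_exp_weight g N Cg Hg))).
  simpl. ring.
Qed.

Lemma is_derive_exp_tail g x : (forall x, continuous g x) ->
  is_derive (exp_tail g) x (exp_tail g x - g x).
Proof.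
  intros Hc. unfold exp_tail. set (l := real _).
  assert (D : is_derive (fun x => RInt (fun y => exp (- y) * g y) 0 x) x (exp (- x) * g x)).
  { apply (is_derive_RInt (V := R_NormedModule) (fun y => exp (- y) * g y) _ 0); [|now apply continuous_exp_weight].
    apply filter_forall. intros b. apply (RInt_correct (V := R_CompleteNormedModule)).
    now apply ex_RInt_exp_weight. }
  set (I := fun x => RInt (fun y => exp (- y) * g y) 0 x) in *.
  change (is_derive (fun x => exp x * (l - I x)) x (exp x * (l - I x) - g x)).
  assert (DE : Derive (fun x : R => I x) x = exp (- x) * g x) by now apply is_derive_unique.
  auto_derive; [eexists; exact D|]. rewrite DE.
  rewrite exp_Ropp. assert (P := exp_pos x). field. lra.
Qed.

(** By linearity the average is a contraction in sup norm, so the modulus of continuity in time of g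
    serves unchanged. *)
Lemma sup_curve_exp_tail g : sup_curve g -> (forall t, exists M, forall x, Rabs (g t x) <= M) ->
  sup_curve (fun t => exp_tail (g t)).
Proof.
  intros [H1 H2] HM. split.
  - intros t x. exact (is_derive_continuous _ _ _ (is_derive_exp_tail _ _ (H1 t))).
  - intros t eps. destruct (H2 t eps) as [d Hd]. exists d. intros s Hs x.
    destruct (HM s) as [Ms Hms], (HM t) as [Mt Hmt].
    rewrite <- (exp_tail_minus _ _ Ms Mt) by auto.
    apply exp_tail_le; [|exact (Hd s Hs)].
    intros y. apply (continuous_minus (V := R_NormedModule)); auto.
Qed.

Lemma is_RInt_gen_p_infty (f : R -> R) a (l : R) : (forall b, ex_RInt f a b) ->
  is_lim (RInt f a) p_infty l -> is_RInt_gen f (at_point a) (Rbar_locally p_infty) l.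
Proof.
  intros Hf L P HP. apply Filter_prod with (fun c => c = a) (fun b => P (RInt f a b)).
  - reflexivity.
  - exact (L P HP).
  - intros c b -> Hb. exists (RInt f a b). split; [|exact Hb].
    apply (RInt_correct (V := R_CompleteNormedModule)), Hf.
Qed.

(** Substitution y -> -y: it turns the left half of the convolution into an [exp_tail] of the
    reflected function. *)
Lemma is_RInt_gen_reflect (f : R -> R) a l :
  is_RInt_gen f (at_point (- a)) (Rbar_locally p_infty) l ->
  is_RInt_gen (fun y => f (- y)) (Rbar_locally m_infty) (at_point a) l.
Proof.
  intros H P HP. destruct (H P HP) as [Q R HQ [A HR] HQR].
  apply Filter_prod with (fun c => R (- c)) (fun b => b = a).
  - exists (- A). intros y Hy. apply HR. lra.
  - reflexivity.
  - intros c b Hc ->. destruct (HQR _ _ HQ Hc) as [y [Hy Py]]. simpl in Hy.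
    exists y. split; [|exact Py]. simpl.
    apply (is_RInt_comp_opp (V := R_NormedModule)) in Hy.
    apply (is_RInt_swap (V := R_NormedModule)), (is_RInt_opp (V := R_NormedModule)) in Hy.
    rewrite opp_opp in Hy. revert Hy. apply (is_RInt_ext (V := R_NormedModule)).
    intros z _. apply opp_opp.
Qed.

Lemma is_RInt_gen_exp_tail g M x : (forall x, continuous g x) -> (forall x, Rabs (g x) <= M) ->
  is_RInt_gen (fun y => exp (x - y) * g y) (at_point x) (Rbar_locally p_infty) (exp_tail g x).
Proof.
  intros Hc HM.
  apply (is_RInt_gen_ext (V := R_NormedModule) (fun y => scal (exp x) (exp (- y) * g y))).
  { apply filter_forall. intros [a b] y _. unfold Rminus. rewrite exp_plus.
    change (exp x * (exp (- y) * g y) = exp x * exp (- y) * g y). ring. }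
  apply (is_RInt_gen_scal (V := R_NormedModule)), is_RInt_gen_p_infty;
    [intros b; now apply ex_RInt_exp_weight|].
  apply is_lim_ext with
    (fun b => RInt (fun y => exp (- y) * g y) 0 b - RInt (fun y => exp (- y) * g y) 0 x).
  { intros b. rewrite <- (RInt_Chasles (V := R_CompleteNormedModule) _ 0 x b)
      by now apply ex_RInt_exp_weight.
    change plus with Rplus. simpl. ring. }
  apply (is_lim_minus' _ (fun _ => _)); [now apply is_lim_exp_weight with M|apply is_lim_const].
Qed.

(** Split at y = x: K(x - y) equals exp(x - y)/2 for y > x and -exp(-(x - y))/2 for y < x. *)
Lemma convolution_K g M x : (forall x, continuous g x) -> (forall x, Rabs (g x) <= M) ->
  convolution K g x = / 2 * (exp_tail g x - exp_tail (fun y => g (- y)) (- x)).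
Proof.
  intros Hc HM. unfold convolution.
  apply (is_RInt_gen_unique (V := R_CompleteNormedModule)).
  replace (/ 2 * (exp_tail g x - exp_tail (fun y => g (- y)) (- x)))
    with (plus (scal (- / 2) (exp_tail (fun y => g (- y)) (- x))) (scal (/ 2) (exp_tail g x)))
    by (unfold plus, scal; simpl; unfold mult; simpl; ring).
  apply (is_RInt_gen_Chasles (V := R_NormedModule)) with x.
  - apply (is_RInt_gen_ext (V := R_NormedModule)
      (fun y => scal (- / 2) (exp (- x - - y) * g (- - y)))).
    (* Restricting to a < x orients the interval and fixes the sign of x - y in its interior; the
       extensionality lemma compares only interior points, so the jump of [K] at y = x is never
       met. *)
    + apply Filter_prod with (fun a => a < x) (fun b => b = x); [now exists x|reflexivity|].
      intros a b Ha -> y Hy. simpl in Hy. rewrite Rmin_left, Rmax_right in Hy by lra.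
      unfold K. rewrite Ropp_involutive, (sign_eq_1 (x - y)), (Rabs_right (x - y)) by lra.
      replace (- x - - y) with (- (x - y)) by ring.
      unfold scal; simpl; unfold mult; simpl. ring.
    + apply (is_RInt_gen_scal (V := R_NormedModule)).
      apply (is_RInt_gen_reflect (fun y => exp (- x - y) * g (- y))).
      apply (is_RInt_gen_exp_tail (fun y => g (- y)) M); [|intros; apply HM].
      intros y. apply (continuous_comp Ropp g); [|apply Hc].
      apply (continuous_opp (V := R_NormedModule)), continuous_id.
  - apply (is_RInt_gen_ext (V := R_NormedModule) (fun y => scal (/ 2) (exp (x - y) * g y))).
    + apply Filter_prod with (fun a => a = x) (fun b => x < b); [reflexivity|now exists x|].
      intros a b -> Hb y Hy. simpl in Hy. rewrite Rmin_left, Rmax_right in Hy by lra.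
      unfold K. rewrite (sign_eq_m1 (x - y)), (Rabs_left (x - y)), Ropp_involutive by lra.
      unfold scal; simpl; unfold mult; simpl. ring.
    + apply (is_RInt_gen_scal (V := R_NormedModule)). now apply is_RInt_gen_exp_tail with M.
Qed.

(** * Gain of one derivative *)

(** The assumed bound at order k is what starts the bootstrap: for a solution the integral equals u0
    - u(t), which is known to be in $C^{k,\theta}$. *)
Lemma holder_bound_RInt_convolution k theta g t M :
  0 <= theta <= 1 -> holder_curve k theta g ->
  holder_bound k theta M (fun x => RInt (fun s => convolution K (g s) x) 0 t) ->
  exists N, holder_bound (S k) theta N (fun x => RInt (fun s => convolution K (g s) x) 0 t).
Proof.
  intros Ht Hg HM. assert (Hs := holder_curve_sup _ _ _ Hg).
  destruct (holder_curve_bounded _ _ _ (Rmin 0 t) (Rmax 0 t) Hg) as [B HB].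
  assert (HA : forall s, exists A, forall x, Rabs (g s x) <= A).
  { intros s. destruct (proj1 Hg s) as [A HA]. exists A. intros x.
    exact (holder_bound_abs _ _ _ _ x HA). }
  set (P := fun s => exp_tail (g s)).
  set (g' := fun s y => g s (- y)).
  set (Q := fun s x => exp_tail (g' s) (- x)).
  assert (Hs' : sup_curve g') by now apply sup_curve_reflect.
  assert (SP : sup_curve P) by now apply sup_curve_exp_tail.
  assert (SQ : sup_curve Q).
  { apply (sup_curve_reflect (fun s => exp_tail (g' s))), sup_curve_exp_tail; [exact Hs'|].
    intros s. destruct (HA s) as [A H]. exists A. intros x. apply H. }
  set (w := fun x => RInt (fun s => convolution K (g s) x) 0 t) in *.
  set (IP := fun x => RInt (fun s => P s x) 0 t).
  set (IQ := fun x => RInt (fun s => Q s x) 0 t).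
  set (Ig := fun x => RInt (fun s => g s x) 0 t).
  assert (Ew : forall x, w x = / 2 * (IP x - IQ x)).
  { intros x. unfold w, IP, IQ.
    rewrite <- RInt_minus_R by now apply sup_curve_ex_RInt.
    rewrite <- RInt_scal_R.
    - apply RInt_ext. intros s _. destruct (HA s) as [A H].
      apply (convolution_K (g s) A x); [apply Hs|exact H].
    - apply (ex_RInt_minus (V := R_NormedModule)); now apply sup_curve_ex_RInt. }
  assert (DP : forall x, is_derive IP x (IP x - Ig x)).
  { intros x. unfold IP at 2, Ig.
    rewrite <- RInt_minus_R by now apply sup_curve_ex_RInt.
    apply (is_derive_RInt_curve P (fun s x => P s x - g s x));
      [exact SP|now apply sup_curve_minus|].
    intros s y. apply is_derive_exp_tail, Hs. }
  (* [Q] is an [exp_tail] evaluated at -x, so the chain rule reverses the sign of Q - g. *)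
  assert (DQ : forall x, is_derive IQ x (Ig x - IQ x)).
  { intros x. unfold IQ at 2, Ig.
    rewrite <- RInt_minus_R by now apply sup_curve_ex_RInt.
    apply (is_derive_RInt_curve Q (fun s x => g s x - Q s x));
      [exact SQ|now apply sup_curve_minus|].
    intros s y.
    assert (D := is_derive_exp_tail (g' s) (- y) (proj1 Hs' s)).
    assert (D' := is_derive_comp (V := R_NormedModule) (exp_tail (g' s)) Ropp y _ _ D
      (is_derive_opp (V := R_NormedModule) (fun x => x) y _ (is_derive_id y))).
    replace (g s y - Q s y) with (scal (opp (one (K := R_AbsRing))) (exp_tail (g' s) (- y) - g' s (- y)));
      [exact D'|].
    unfold Q, g' at 2. rewrite Ropp_involutive.
    unfold scal, opp, one; simpl; unfold mult; simpl. ring. }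
  (* [z] is the time integral of [(1 - d^2/dx^2)^-1 (g s)]. *)
  set (z := fun x => / 2 * (IP x + IQ x)).
  assert (Dz : forall x, is_derive z x (w x)).
  { intros x. rewrite Ew. replace (/ 2 * (IP x - IQ x))
      with (/ 2 * ((IP x - Ig x) + (Ig x - IQ x))) by ring.
    apply is_derive_scal. now apply (is_derive_plus (V := R_NormedModule)). }
  assert (Dw : forall x, is_derive w x (z x - Ig x)).
  { intros x. apply (is_derive_ext (fun x => / 2 * (IP x - IQ x))); [intros; now rewrite Ew|].
    replace (z x - Ig x) with (/ 2 * ((IP x - Ig x) - (Ig x - IQ x))) by (unfold z; field).
    apply is_derive_scal. now apply (is_derive_minus (V := R_NormedModule)). }
  assert (Bz : forall x, Rabs (z x) <= B * Rabs (t - 0)).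
  { intros x. unfold z.
    assert (B1 : Rabs (IP x) <= B * Rabs (t - 0)).
    { apply Rabs_RInt_le; [now apply sup_curve_ex_RInt|]. intros s Hst.
      apply exp_tail_le; [apply Hs|]. intros y. exact (holder_bound_abs _ _ _ _ y (HB s Hst)). }
    assert (B2 : Rabs (IQ x) <= B * Rabs (t - 0)).
    { apply Rabs_RInt_le; [now apply sup_curve_ex_RInt|]. intros s Hst.
      apply exp_tail_le; [apply Hs'|]. intros y. exact (holder_bound_abs _ _ _ _ (- y) (HB s Hst)). }
    rewrite Rabs_mult, (Rabs_right (/ 2)) by lra.
    assert (B3 := Rabs_triang (IP x) (IQ x)). lra. }
  assert (M0 := holder_bound_ge0 _ _ _ _ HM).
  assert (B0 := Rle_trans _ _ _ (Rabs_pos _) (Bz 0)).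
  (* One constant must dominate both [z], by its sup bound, and z' = w, by M; lowering the order by
     one then doubles it. *)
  set (N1 := M + B * Rabs (t - 0)).
  assert (Hz : holder_bound k theta (2 * N1) z).
  { apply holder_bound_lower with theta; [exact Ht|]. split.
    - intros x. specialize (Bz x). unfold N1. lra.
    - exists w. split; [exact Dz|]. apply holder_bound_le with M; [unfold N1; lra|exact HM]. }
  assert (HI := holder_bound_RInt _ _ _ _ _ _ Hg HB).
  assert (HD := holder_bound_minus _ _ _ _ _ _ Hz HI).
  assert (D0 := holder_bound_ge0 _ _ _ _ HD).
  exists (M + (2 * N1 + B * Rabs (t - 0))). split.
  - intros x. assert (X := holder_bound_abs _ _ _ _ x HM). lra.
  - exists (fun x => z x - Ig x). split; [exact Dw|].
    refine (holder_bound_le _ _ _ _ _ _ HD). lra.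
Qed.

(** * Solutions: extension in time and transfer of singularities *)

(** Nothing is known about u outside [-T,T]. Freezing time at the endpoints gives a curve on all of
    R that agrees with u on [-T,T], and the map is 1-Lipschitz, so continuity in time is kept. *)
Definition clamp (T t : R) : R := Rmax (- T) (Rmin T t).

Lemma clamp_between T t : 0 < T -> - T <= clamp T t <= T.
Proof. intros. unfold clamp, Rmax, Rmin. repeat destruct Rle_dec; lra. Qed.

Lemma clamp_id T t : - T <= t <= T -> clamp T t = t.
Proof. intros. unfold clamp, Rmax, Rmin. repeat destruct Rle_dec; lra. Qed.

Lemma clamp_lipschitz T s t : 0 < T -> Rabs (clamp T s - clamp T t) <= Rabs (s - t).
Proof.
  intros. unfold clamp, Rmax, Rmin, Rabs.
  repeat destruct Rle_dec; repeat destruct Rcase_abs; lra.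
Qed.

Lemma holder_curve_clamp T k theta u : 0 < T -> continuous_curve T k theta u ->
  holder_curve k theta (fun t => u (clamp T t)).
Proof.
  intros HT [H1 H2].
  assert (B : forall t, exists M, holder_bound k theta M (u (clamp T t))).
  { intros t. apply holder_space_iff, H1. now apply clamp_between. }
  split; [exact B|]. intros t eps.
  destruct (H2 (clamp T t) (clamp_between T t HT) eps) as [d Hd]. exists d. intros s Hs.
  destruct (B s) as [Ms Hms], (B t) as [Mt Hmt].
  apply holder_bound_of_norm.
  - assert (D := holder_bound_minus _ _ _ _ _ _ Hms Hmt).
    now apply holder_bound_iff in D.
  - apply Rbar_lt_le, Hd; [now apply clamp_between|].
    eapply Rle_lt_trans; [now apply clamp_lipschitz|exact Hs].
Qed.

Lemma local_solution_increment T k theta u0 u t :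
  0 <= theta <= 1 -> holder_space k theta u0 -> 0 < T ->
  local_solution T k theta u0 u -> - T <= t <= T ->
  exists M, holder_bound (S k) theta M (fun x => u0 x - u t x).
Proof.
  intros Hth H0 HT [Hc He] Ht.
  set (g := fun s x => u (clamp T s) x + (u (clamp T s) x) ^ 2 / 2).
  assert (Hg : holder_curve k theta g).
  { apply (holder_curve_flux k theta (fun s => u (clamp T s)) Hth).
    now apply holder_curve_clamp. }
  assert (E : forall x, u0 x - u t x = RInt (fun s => convolution K (g s) x) 0 t).
  { intros x. rewrite (He t x Ht).
    rewrite (RInt_ext (fun s => convolution K (g s) x)
      (fun s => convolution K (fun y => u s y + (u s y) ^ 2 / 2) x)); [ring|].
    intros s Hs. unfold g. rewrite clamp_id; [reflexivity|].
    revert Hs. unfold Rmin, Rmax. destruct Rle_dec; lra. }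
  apply functional_extensionality in E.
  apply holder_space_iff in H0. destruct H0 as [M0 H0].
  destruct (proj1 (holder_space_iff _ _ _) (proj1 Hc t Ht)) as [Mt Hmt].
  assert (D := holder_bound_minus _ _ _ _ _ _ H0 Hmt).
  rewrite E in *. now apply holder_bound_RInt_convolution with (M0 + Mt).
Qed.

Lemma holder_at_plus k theta f w x :
  holder_space k theta w -> holder_at k theta f x -> holder_at k theta (fun y => f y + w y) x.
Proof.
  intros Hw [a [b [Hx [g [Hg E]]]]]. exists a, b. split; [exact Hx|].
  exists (fun y => g y + w y). split.
  - apply holder_space_iff in Hw, Hg. destruct Hw as [M Hw], Hg as [N Hg].
    apply holder_space_iff. exists (N + M). now apply holder_bound_plus.
  - intros y Hy. now rewrite E.
Qed.

Theorem corollary1p19 (k : nat) (theta : R) (u0 : R -> R) (T : R) (u : R -> R -> R)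
  (htheta : 0 <= theta <= 1)
  (hu0 : holder_space k theta u0)
  (hT : 0 < T)
  (hu : local_solution T k theta u0 u) :
  forall t : R, - T <= t <= T ->
  forall (j : nat) (eta : R),
    j = k \/ j = S k ->
    0 <= eta <= 1 ->
    INR j + eta <= INR k + 1 + theta ->
    forall x : R, Upsilon j eta (u t) x <-> Upsilon j eta u0 x.
Proof.
  intros t Ht j eta Hj He Hle x.
  destruct (local_solution_increment _ _ _ _ _ t htheta hu0 hT hu Ht) as [M HM].
  (* For j = k the gained derivative pays for every eta in [0,1]; for j = k + 1 the index condition
     reduces to eta <= theta. *)
  assert (W : holder_bound j eta (2 * M) (fun x => u0 x - u t x)).
  { destruct Hj as [-> | ->].
    - now apply holder_bound_lower with theta.
    - rewrite S_INR in Hle. apply holder_bound_exponent with theta; [lra|exact HM]. }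
  assert (E1 : (fun y => u t y + (u0 y - u t y)) = u0).
  { apply functional_extensionality. intros y. ring. }
  assert (E2 : (fun y => u0 y + -1 * (u0 y - u t y)) = u t).
  { apply functional_extensionality. intros y. ring. }
  assert (V := holder_bound_scal _ _ _ (-1) _ W).
  (* Regular points are carried over both ways, since u0 = u(t) + w and u(t) = u0 - w with w
     globally of class $C^{j,\eta}$. *)
  apply not_iff_compat. split; intros H.
  - rewrite <- E1. apply holder_at_plus; [|exact H]. apply holder_space_iff. eauto.
  - rewrite <- E2. apply (holder_at_plus j eta u0 (fun y => -1 * (u0 y - u t y))); [|exact H].
    apply holder_space_iff. eauto.
Qed.
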